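(* Let $d_{\rm Eucl}(x,y):=|x-y|$ be the Euclidean distance on $\mathbb R^2$, let $\Omega:=(0,1)^2\subseteq\mathbb R^2$ be the open unit square, and let $d:=2\,d_{\rm Eucl}|_{\Omega\times\Omega}\in\mathcal D_2(\Omega,d_{\rm Eucl})$. Then there exist an increasing sequence $(d_n)_{n\in\mathbb N}\subseteq\mathcal D_2(\Omega,d_{\rm Eucl})$ and a distance $\tilde d$ on $\Omega$ with $\tilde d\neq d$ such that $L_{d_n}\xrightarrow{\Gamma}L_d$ in $\mathrm{Lip}([0,1];\Omega)$ and $d_n\to\tilde d$ uniformly on compact subsets of $\Omega\times\Omega$.
   Context: Length: for a metric space $(E,\rho)$ and a continuous curve $\gamma\colon[a,b]\to E$, $L_\rho(\gamma):=\sup\{\sum_{i=1}^k\rho(\gamma_{t_i},\gamma_{t_{i-1}}) : k\in\mathbb N,\ a=t_0<t_1<\dots<t_k=b\}\in[0,+\infty]$. $(E,\rho)$ is a length space if $\rho(x,y)=\inf\{L_\rho(\gamma) : \gamma\colon[0,1]\to E \text{ Lipschitz},\ \gamma_0=x,\ \gamma_1=y\}$ for all $x,y\in E$. $\mathcal D_2(\Omega,d_{\rm Eucl})$ is the set of all distances $\rho$ on $\Omega$ such that $(\Omega,\rho)$ is a length space and $\frac12|x-y|\le\rho(x,y)\le2|x-y|$ for all $x,y\in\Omega$. A sequence $(d_n)$ of distances on $\Omega$ is increasing if $d_n(x,y)\le d_{n+1}(x,y)$ for all $n$ and all $x,y\in\Omega$. $\mathrm{Lip}([0,1];\Omega)$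 is the set of Lipschitz curves from $[0,1]$ to $\Omega$ (with respect to the Euclidean distance), with the topology of uniform convergence. The functionals $L_{d_n}$, $L_d$ are restricted to this space. $\Gamma$-convergence: functionals $G_n\colon T\to[0,+\infty]$ on a topological space $T$ $\Gamma$-converge to $G\colon T\to[0,+\infty]$, written $G_n\xrightarrow{\Gamma}G$, if for every $x\in T$: $G(x)\le\liminf_n G_n(x_n)$ for every sequence $x_n\to x$ in $T$; and there is a sequence $x_n\to x$ in $T$ with $\limsup_n G_n(x_n)\le G(x)$. *)

(* Defs.v *)
From HB Require Import structures.
From mathcomp Require Import all_boot all_order all_algebra.
From mathcomp Require Import all_classical all_reals all_analysis.
Import Order.TTheory GRing.Theory Num.Theory.
Import numFieldNormedType.Exports.

Set Implicit Arguments.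
Unset Strict Implicit.
Unset Printing Implicit Defensive.

Local Open Scope classical_set_scope.
Local Open Scope ring_scope.

Record is_distance (R : realType) (E : Type) (rho : E -> E -> R) : Prop := {
  distance_ge0 : forall x y, 0 <= rho x y;
  distance_eq0 : forall x y, rho x y = 0 <-> x = y;
  distance_sym : forall x y, rho x y = rho y x;
  distance_triangle : forall x y z, rho x z <= rho x y + rho y z }.

(* A curve [a, b] -> E is represented by a function R -> E; its values outside
   [a, b] are never used. *)

(* The partition a = t_0 < t_1 < ... < t_k = b is encoded by
   s = [:: t_1; ...; t_k]. *)
Definition curve_length (R : realType) (E : Type) (rho : E -> E -> R)
    (a b : R) (g : R -> E) : \bar R :=
  ereal_sup [set (\sum_(i < size s)
                    rho (g (nth a (a :: s) i.+1)) (g (nth a (a :: s) i)))%:E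
            | s in itv_partition a b].

Definition lipschitz_curve (R : realType) (E : Type) (rho : E -> E -> R)
    (g : R -> E) : Prop :=
  exists k : R, {in `[0, 1] &, forall s t, rho (g s) (g t) <= k * `|s - t|}.

Definition length_space (R : realType) (E : Type) (rho : E -> E -> R) : Prop :=
  is_distance rho /\
  forall x y : E,
    (rho x y)%:E =
    ereal_inf [set curve_length rho 0 1 g
              | g in [set g | [/\ lipschitz_curve rho g, g 0 = x & g 1 = y]]].

Definition Omega (R : realType) : set (R * R) := `]0, 1[ `*` `]0, 1[.
Arguments Omega : clear implicits.

(* The library norm on R * R is the max norm, hence the explicit formula. *)
Definition eucl (R : realType) (p q : R * R) : R :=
  Num.sqrt ((p.1 - q.1) ^+ 2 + (p.2 - q.2) ^+ 2).

Definition eucl_Omega (R : realType) (x y : Omega R) : R :=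
  eucl (val x) (val y).

Definition D2 (R : realType) : set (Omega R -> Omega R -> R) :=
  [set rho | length_space rho /\
             forall x y, 2^-1 * eucl_Omega x y <= rho x y <= 2 * eucl_Omega x y].

(* The topology on Lip is the one induced on a set_type by the topology of
   uniform convergence on [0, 1]. The uniformity on Omega comes from the max
   norm, which is equivalent to the Euclidean norm. Two curves that agree on
   [0, 1] are topologically indistinguishable. *)
Definition Lip (R : realType) : set {uniform` `[0 : R, 1] -> Omega R} :=
  [set g | lipschitz_curve (@eucl_Omega R) g].
Arguments Lip : clear implicits.

Definition length_Lip (R : realType) (rho : Omega R -> Omega R -> R)
    (g : Lip R) : \bar R :=
  curve_length rho 0 1 (val g).

Definition Gamma_cvg (R : realType) (T : topologicalType)
    (G_ : nat -> T -> \bar R) (G : T -> \bar R) : Prop :=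
  forall x : T,
    (forall x_ : nat -> T, x_ @ \oo --> x ->
      (G x <= limn_einf (fun n => G_ n (x_ n)))%E) /\
    (exists2 x_ : nat -> T, x_ @ \oo --> x &
      (limn_esup (fun n => G_ n (x_ n)) <= G x)%E).

Definition increasing_distances (R : realType) (E : Type)
    (d_ : nat -> E -> E -> R) : Prop :=
  forall n x y, d_ n x y <= d_ n.+1 x y.

(* Main.v *)
Require Import Defs.
From HB Require Import structures.
From mathcomp Require Import all_boot all_order all_algebra.
From mathcomp Require Import all_classical all_reals all_analysis.
From mathcomp Require Import ring lra.
Import Order.TTheory GRing.Theory Num.Theory.
Import numFieldNormedType.Exports.

Set Implicit Arguments.
Unset Strict Implicit.
Unset Printing Implicit Defensive.

Local Open Scope classical_set_scope.
Local Open Scope ring_scope.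

(** Travelling in the square costs twice the Euclidean length, except in a thin
    strip [S] along the bottom edge, where the cost is the Euclidean length
    itself.  Let [d_S] be the resulting distance.  As the strip shrinks, [d_S]
    increases.  A given curve in the open square has compact image, so it
    keeps a positive distance to the bottom edge, and so do the curves
    uniformly close to it: once the strip is thin enough, none of them sees it,
    and their [d_S]-length is twice the Euclidean one.  Gamma-convergence of
    the lengths to [L_d] thus reduces to lower semicontinuity of the Euclidean
    length.  The distances however remember the strip: a minimising sequence
    of curves may run closer and closer to the edge, and in the limit
    [d_S(x, y)] becomes the distance for which the edge itself is a cheap road,
    which differs from [d] at points that are near the edge and far apart.

    Instead of minimising a weighted length over curves, [d_S] is given
    explicitly.  Since the cheap region is convex, an optimal route is either
    the straight segment, or goes straight to some [s] in [S], straight to some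
    [t] in [S], and straight to its goal; [shortcut] is the infimum of these
    costs.  The formula makes sense for any set in any metric space, so the
    bottom edge, which lies outside the open square, is a legitimate choice of
    [S] and gives the limit ([dist_shortcut_strip] bounds the error
    by a multiple of the width), while the empty set gives [d].

    Two points carry the proof.  The distance [d_S] is a length distance
    ([shortcut_Omega_length_space]), because a route is realised by a polygonal
    curve whose [d_S]-length is at most its cost.  And if [x] is no farther from
    [y] than from [S], then [d_S(x, y)] is exactly [2 |x - y|] ([shortcut_far]), so
    on a Lipschitz curve away from [S] both distances agree at small scale,
    hence give the same length ([length_le_shortcut]). *)

(** * Distances with a cheap region *)

Definition route_costs (R : realType) (E : Type) (e : E -> E -> R) (S : set E)
    (x y : E) : set R :=
  [set r | r = 2 * e x y \/
           exists s t, [/\ S s, S t & r = 2 * e x s + e s t + 2 * e t y]].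

Definition shortcut (R : realType) (E : Type) (e : E -> E -> R) (S : set E)
    (x y : E) : R :=
  inf (route_costs e S x y).

Lemma is_distance_pullback (R : realType) (E F : Type) (f : F -> E)
    (rho : E -> E -> R) :
  injective f -> is_distance rho -> is_distance (fun x y => rho (f x) (f y)).
Proof.
move=> finj [ge0 eq0 sym tri]; split=> [x y|x y|x y|x y z] //.
by rewrite eq0; split=> [/finj|->].
Qed.

Lemma distance_xx (R : realType) (E : Type) (e : E -> E -> R) (x : E) :
  is_distance e -> e x x = 0.
Proof. by move=> de; apply/(distance_eq0 de). Qed.

(** Gives the bound below that makes the infimum in [shortcut] meaningful. *)
Lemma le_route_cost (R : realType) (E : Type) (e : E -> E -> R) (S : set E)
    (x y : E) :
  is_distance e -> lbound (route_costs e S x y) (e x y).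
Proof.
move=> de r [->|[s [t [_ _ ->]]]].
  by have := distance_ge0 de x y; lra.
have := distance_triangle de x s y; have := distance_triangle de s t y.
have := distance_ge0 de x s; have := distance_ge0 de t y; lra.
Qed.

Lemma shortcut_le (R : realType) (E : Type) (e : E -> E -> R) (S : set E)
    (x y : E) (r : R) :
  is_distance e -> route_costs e S x y r -> shortcut e S x y <= r.
Proof.
by move=> de; apply: ge_inf; exists (e x y); exact: le_route_cost.
Qed.

Lemma le_shortcut (R : realType) (E : Type) (e : E -> E -> R) (S : set E)
    (x y : E) (r : R) :
  lbound (route_costs e S x y) r -> r <= shortcut e S x y.
Proof. by apply: lb_le_inf; exists (2 * e x y); left. Qed.

Lemma shortcut_le2 (R : realType) (E : Type) (e : E -> E -> R) (S : set E)
    (x y : E) :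
  is_distance e -> shortcut e S x y <= 2 * e x y.
Proof. by move=> de; apply: shortcut_le => //; left. Qed.

Lemma shortcut_ge (R : realType) (E : Type) (e : E -> E -> R) (S : set E)
    (x y : E) :
  is_distance e -> e x y <= shortcut e S x y.
Proof. by move=> de; apply/le_shortcut/le_route_cost. Qed.

Lemma shortcut_fast (R : realType) (E : Type) (e : E -> E -> R) (S : set E)
    (s t : E) :
  is_distance e -> S s -> S t -> shortcut e S s t <= e s t.
Proof.
move=> de Ss St; apply: shortcut_le => //; right; exists s, t; split=> //.
by rewrite !distance_xx// mulr0 add0r addr0.
Qed.

(** Merely reaching [S] already costs [2 * e x s], which is no less than
    [2 * e x y]. *)
Lemma shortcut_far (R : realType) (E : Type) (e : E -> E -> R) (S : set E)
    (x y : E) :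
  is_distance e -> (forall s, S s -> e x y <= e x s) ->
  shortcut e S x y = 2 * e x y.
Proof.
move=> de far; apply/eqP; rewrite eq_le shortcut_le2//=.
apply: le_shortcut => r [->//|[s [t [Ss _ ->]]]].
have := far s Ss; have := distance_ge0 de s t; have := distance_ge0 de t y.
lra.
Qed.

Lemma shortcut0 (R : realType) (E : Type) (e : E -> E -> R) :
  is_distance e -> shortcut e set0 = (fun x y => 2 * e x y).
Proof. by move=> de; apply/funext=> x; apply/funext=> y; exact: shortcut_far. Qed.

Lemma shortcut_anti (R : realType) (E : Type) (e : E -> E -> R) (S S' : set E)
    (x y : E) :
  is_distance e -> S `<=` S' -> shortcut e S' x y <= shortcut e S x y.
Proof.
move=> de SS'; apply: le_shortcut => r rc; apply: shortcut_le => //.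
case: rc => [->|[s [t [Ss St ->]]]]; first by left.
by right; exists s, t; split=> //; exact: SS'.
Qed.

(** Moving the two points where a route enters and leaves [S] by at most [h]
    adds at most [2 * h] to each of the two slow legs, and at most [2 * h] to the
    cheap leg. *)
Lemma shortcut_close (R : realType) (E : Type) (e : E -> E -> R)
    (S S' : set E) (h : R) (x y : E) :
  is_distance e -> 0 <= h ->
  (forall s, S s -> exists2 s', S' s' & e s s' <= h) ->
  shortcut e S' x y <= shortcut e S x y + 6 * h.
Proof.
move=> de h0 near; rewrite -lerBlDr; apply: le_shortcut => r.
rewrite lerBlDr => -[->|[s [t [Ss St ->]]]].
  by have := shortcut_le2 S' x y de; lra.
have [s' Ss' ss'] := near s Ss; have [t' St' tt'] := near t St.
have cost' : route_costs e S' x y (2 * e x s' + e s' t' + 2 * e t' y).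
  by right; exists s', t'.
have := shortcut_le de cost'.
have := distance_triangle de x s s'; have := distance_triangle de t' t y.
have := distance_triangle de s' s t'; have := distance_triangle de s t t'.
rewrite (distance_sym de s' s) (distance_sym de t' t); lra.
Qed.

(** The triangle inequality holds because a concatenation of two routes can be
    replaced by a single route that is not more expensive. *)
Lemma shortcut_is_distance (R : realType) (E : Type) (e : E -> E -> R)
    (S : set E) :
  is_distance e -> is_distance (shortcut e S).
Proof.
move=> de.
have sym_le x y : shortcut e S x y <= shortcut e S y x.
  apply: le_shortcut => r rc; apply: shortcut_le => //.
  case: rc => [->|[s [t [Ss St ->]]]]; first by left; rewrite (distance_sym de).
  right; exists t, s; split=> //.
  rewrite (distance_sym de y) (distance_sym de s t) (distance_sym de t x).
  by ring.
split=> [x y|x y|x y|x y z].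
- exact: le_trans (distance_ge0 de x y) (shortcut_ge S x y de).
- split=> [xy0|->].
    apply/(distance_eq0 de)/eqP; rewrite eq_le (distance_ge0 de) andbT -xy0.
    exact: shortcut_ge.
  apply/eqP; rewrite eq_le.
  have := shortcut_le2 S y y de; have := shortcut_ge S y y de.
  by rewrite (distance_xx _ de) mulr0 => -> ->.
- by apply/eqP; rewrite eq_le !sym_le.
- have concat r1 r2 : route_costs e S x y r1 -> route_costs e S y z r2 ->
      shortcut e S x z <= r1 + r2.
    move=> [->|[s [t [Ss St ->]]]] [->|[s' [t' [Ss' St' ->]]]].
    + have := shortcut_le2 S x z de; have := distance_triangle de x y z; lra.
    + have c : route_costs e S x z (2 * e x s' + e s' t' + 2 * e t' z).
        by right; exists s', t'.
      have := shortcut_le de c; have := distance_triangle de x y s'; lra.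
    + have c : route_costs e S x z (2 * e x s + e s t + 2 * e t z).
        by right; exists s, t.
      have := shortcut_le de c; have := distance_triangle de t y z; lra.
    (* Both routes use [S]: go directly from the first entry [s] to the
       last exit [t'], skipping the detour through [y]. *)
    + have c : route_costs e S x z (2 * e x s + e s t' + 2 * e t' z).
        by right; exists s, t'.
      have := shortcut_le de c; have := distance_triangle de s t t'.
      have := distance_triangle de t s' t'; have := distance_triangle de t y s'.
      have := distance_ge0 de t y; have := distance_ge0 de y s'; lra.
  rewrite -lerBlDr; apply: le_shortcut => r1 c1.
  rewrite lerBlDr addrC -lerBlDr; apply: le_shortcut => r2 c2.
  by rewrite lerBlDr addrC; exact: concat.
Qed.

(** * Lengths of curves *)

(** The sums of which [curve_length] is the supremum; named so that they can be
    computed by recursion on the partition. *)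
Definition partition_sum (R : realType) (E : Type) (rho : E -> E -> R)
    (g : R -> E) (a : R) (s : seq R) : R :=
  \sum_(i < size s) rho (g (nth a (a :: s) i.+1)) (g (nth a (a :: s) i)).

Lemma partition_sum_cons (R : realType) (E : Type) (rho : E -> E -> R)
    (g : R -> E) (a b : R) (s : seq R) :
  partition_sum rho g a (b :: s) = rho (g b) (g a) + partition_sum rho g b s.
Proof.
rewrite /partition_sum big_ord_recl /=; congr (_ + _).
apply: eq_bigr => i _ /=.
rewrite (set_nth_default b a) ?ltn_ord//.
by rewrite -!/(nth _ (b :: s) i) (set_nth_default b a)//= ltnS ltnW// ltn_ord.
Qed.

Lemma partition_sum_cat (R : realType) (E : Type) (rho : E -> E -> R)
    (g : R -> E) (a : R) (s s' : seq R) :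
  partition_sum rho g a (s ++ s') =
  partition_sum rho g a s + partition_sum rho g (last a s) s'.
Proof.
elim: s a => [|b s IH] a /=; first by rewrite /partition_sum big_ord0 add0r.
by rewrite !partition_sum_cons IH addrA.
Qed.

Lemma partition_sum1 (R : realType) (E : Type) (rho : E -> E -> R)
    (g : R -> E) (a b : R) :
  partition_sum rho g a [:: b] = rho (g b) (g a).
Proof. by rewrite partition_sum_cons /partition_sum big_ord0 addr0. Qed.

Lemma curve_length_ge (R : realType) (E : Type) (rho : E -> E -> R)
    (g : R -> E) (a b : R) (s : seq R) :
  itv_partition a b s ->
  ((partition_sum rho g a s)%:E <= curve_length rho a b g)%E.
Proof. by move=> ps; apply: ereal_sup_ubound; exists s. Qed.

Lemma curve_length_le (R : realType) (E : Type) (rho : E -> E -> R)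
    (g : R -> E) (a b : R) (M : \bar R) :
  (forall s, itv_partition a b s -> ((partition_sum rho g a s)%:E <= M)%E) ->
  (curve_length rho a b g <= M)%E.
Proof. by move=> sM; apply: ge_ereal_sup => _ [s ps <-]; exact: sM. Qed.

Lemma le_curve_length (R : realType) (E : Type) (rho rho' : E -> E -> R)
    (g : R -> E) (a b : R) :
  (forall x y, rho x y <= rho' x y) ->
  (curve_length rho a b g <= curve_length rho' a b g)%E.
Proof.
move=> le; apply: curve_length_le => s /(curve_length_ge rho' g).
by apply: le_trans; rewrite lee_fin; apply: ler_sum => i _.
Qed.

Lemma distance_le_length (R : realType) (E : Type) (rho : E -> E -> R)
    (g : R -> E) (a b : R) :
  a < b -> ((rho (g b) (g a))%:E <= curve_length rho a b g)%E.
Proof.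
move=> /itv_partition1/(curve_length_ge rho g).
by rewrite partition_sum1.
Qed.

(** For a fixed partition the sum is continuous in the curve: this is what makes
    the length lower semicontinuous under uniform convergence. *)
Lemma partition_sum_close (R : realType) (E : Type) (rho : E -> E -> R)
    (g h : R -> E) (eps a b : R) (s : seq R) :
  is_distance rho -> {in `[a, b], forall t, rho (h t) (g t) <= eps} ->
  itv_partition a b s ->
  partition_sum rho g a s <= partition_sum rho h a s + (size s)%:R * (2 * eps).
Proof.
move=> dr; elim: s a => [|c s IH] a close ps.
  by rewrite /partition_sum !big_ord0 mul0r addr0.
have pc := itv_partition_cons ps.
have ac : a < c by case: ps => /= /andP[].
have cb := itv_partition_le pc.
have {}IH : partition_sum rho g c s <=
    partition_sum rho h c s + (size s)%:R * (2 * eps).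
  by apply: IH => // t tI; apply: close; move: tI; rewrite !in_itv/=; lra.
rewrite !partition_sum_cons /= -natr1 mulrDl mul1r.
have ha : rho (h a) (g a) <= eps by apply: close; rewrite in_itv/=; lra.
have hc : rho (h c) (g c) <= eps by apply: close; rewrite in_itv/=; lra.
have := distance_triangle dr (g c) (h c) (g a).
have := distance_triangle dr (h c) (h a) (g a).
rewrite (distance_sym dr (g c) (h c)); lra.
Qed.

Lemma partition_sum_lipschitz (R : realType) (E : Type) (rho : E -> E -> R)
    (g : R -> E) (a b k : R) (s : seq R) :
  {in `[a, b] &, forall t u, rho (g t) (g u) <= k * `|t - u|} ->
  itv_partition a b s -> partition_sum rho g a s <= k * (b - a).
Proof.
elim: s a => [|c s IH] a lip ps.
  by rewrite /partition_sum big_ord0 (itv_partition_nil ps) subrr mulr0.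
have pc := itv_partition_cons ps.
have ac : a < c by case: ps => /= /andP[].
have cb := itv_partition_le pc.
have -> : k * (b - a) = k * (b - c) + k * (c - a) by ring.
rewrite partition_sum_cons addrC; apply: lerD.
  apply: IH => // t u; rewrite !in_itv/= => /andP[ct tb] /andP[cu ub].
  by apply: lip; rewrite in_itv/= ?tb ?ub (le_trans (ltW ac)).
rewrite -[X in _ <= _ * X]gtr0_norm ?subr_gt0//.
by apply: lip; rewrite in_itv/= ?lexx ?(ltW ac) ?cb ?(le_trans (ltW ac) cb).
Qed.

Lemma curve_length_lipschitz (R : realType) (E : Type) (rho : E -> E -> R)
    (g : R -> E) (a b k : R) :
  {in `[a, b] &, forall t u, rho (g t) (g u) <= k * `|t - u|} ->
  (curve_length rho a b g <= (k * (b - a))%:E)%E.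
Proof.
move=> lip; apply: curve_length_le => s ps.
by rewrite lee_fin; exact: partition_sum_lipschitz ps.
Qed.

(** When [e] is dominated by [rho] at scale [eta] only, a partition has to be
    refined to steps of size [eta]; by the triangle inequality this does not
    decrease the [e]-sum. *)
Lemma refine_partition_sum (R : realType) (E : Type) (e rho : E -> E -> R)
    (g : R -> E) (eta a b : R) (s : seq R) :
  is_distance e -> 0 < eta ->
  {in `[a, b] &, forall t u, `|t - u| <= eta -> e (g t) (g u) <= rho (g t) (g u)} ->
  itv_partition a b s ->
  exists2 s', itv_partition a b s' &
    partition_sum e g a s <= partition_sum rho g a s'.
Proof.
move=> de eta0.
(* One interval: cut it into [N] pieces of length at most [eta]. *)
have refine1 N : forall c d, c <= d -> d - c <= N%:R * eta ->
    {in `[c, d] &, forall t u, `|t - u| <= eta ->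
      e (g t) (g u) <= rho (g t) (g u)} ->
    exists2 s', itv_partition c d s' & e (g d) (g c) <= partition_sum rho g c s'.
  elim: N => [|N IH] c d; rewrite le_eqVlt => /orP[/eqP<- _ _|cd dc eP].
  - by exists [::]; rewrite ?distance_xx// /partition_sum ?big_ord0.
  - by move: dc; rewrite mul0r; lra.
  - by exists [::]; rewrite ?distance_xx// /partition_sum ?big_ord0.
  have [dceta|dceta] := leP (d - c) eta.
    exists [:: d]; first exact: itv_partition1.
    rewrite partition_sum1; apply: eP; rewrite ?in_itv/= ?lexx ?(ltW cd)//.
    by rewrite gtr0_norm// subr_gt0.
  have [s1 ps1 le1] : exists2 s', itv_partition (c + eta) d s' &
      e (g d) (g (c + eta)) <= partition_sum rho g (c + eta) s'.
    apply: IH => [||t u tI uI]; first lra.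
      by move: dc; rewrite -natr1 mulrDl mul1r; lra.
    by apply: eP; move: tI uI; rewrite !in_itv/=; lra.
  have cce : c < c + eta by rewrite ltrDl.
  exists ([:: c + eta] ++ s1).
    by apply: itv_partition_cat ps1; exact: itv_partition1.
  rewrite partition_sum_cat/= partition_sum1 addrC.
  apply: le_trans (distance_triangle de _ (g (c + eta)) _) _.
  apply: lerD => //; apply: eP; rewrite ?in_itv/=; try lra.
  by rewrite gtr0_norm; lra.
elim: s a => [|c s IH] a eP ps.
  exists [::] => //.
  by rewrite /partition_sum !big_ord0.
have pc := itv_partition_cons ps.
have ac : a < c by case: ps => /= /andP[].
have cb := itv_partition_le pc.
have [s2 ps2 le2] : exists2 s', itv_partition c b s' &
    partition_sum e g c s <= partition_sum rho g c s'.
  apply: IH => // t u tI uI; apply: eP; move: tI uI; rewrite !in_itv/=; lra.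
have [s1 ps1 le1] : exists2 s', itv_partition a c s' &
    e (g c) (g a) <= partition_sum rho g a s'.
  apply: (refine1 (Num.truncn ((c - a) / eta)).+1); first exact: ltW.
    by rewrite -ler_pdivrMr//; apply/ltW/truncnS_gt.
  by move=> t u tI uI; apply: eP; move: tI uI; rewrite !in_itv/=; lra.
exists (s1 ++ s2); first exact: itv_partition_cat ps1 ps2.
rewrite partition_sum_cons partition_sum_cat.
by case: ps1 => _ /eqP ->; exact: lerD.
Qed.

Lemma curve_length_local (R : realType) (E : Type) (e rho : E -> E -> R)
    (g : R -> E) (eta a b : R) :
  is_distance e -> 0 < eta ->
  {in `[a, b] &, forall t u, `|t - u| <= eta -> e (g t) (g u) <= rho (g t) (g u)} ->
  (curve_length e a b g <= curve_length rho a b g)%E.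
Proof.
move=> de eta0 eP; apply: curve_length_le => s ps.
have [s' ps' le] := refine_partition_sum de eta0 eP ps.
by apply: le_trans (curve_length_ge rho g ps'); rewrite lee_fin.
Qed.

(** * Length spaces from unit-speed curves *)

(** Curves are parametrised on [`[0, l]] with speed at most one, so that
    concatenation adds the parameters [l], whatever the lengths of the pieces;
    rescaling to [`[0, 1]] happens only once, in
    [reachable_length]. *)
Definition reachable (R : realType) (E : Type) (rho : E -> E -> R) (x y : E)
    (l : R) : Prop :=
  0 <= l /\ exists g : R -> E, [/\ g 0 = x, g l = y &
    {in `[0, l] &, forall t u, rho (g t) (g u) <= `|t - u|}].

(** A pair of times on different sides of the junction is handled by the
    triangle inequality through [y], since [`|t - u|] splits at [l]. *)
Lemma reachable_trans (R : realType) (E : Type) (rho : E -> E -> R)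
    (x y z : E) (l m : R) :
  is_distance rho ->
  reachable rho x y l -> reachable rho y z m -> reachable rho x z (l + m).
Proof.
move=> dr [l0 [g [g0 gl gP]]] [m0 [h [h0 hm hP]]].
split; first exact: addr_ge0.
exists (fun t => if t <= l then g t else h (t - l)); split.
- by rewrite l0.
- case: ifPn => [lml|_]; last by rewrite addrC addKr.
  have m00 : m = 0 by move: lml m0; lra.
  by rewrite m00 addr0 gl -h0 -hm m00.
move=> t u; rewrite !in_itv/= => /andP[t0 tlm] /andP[u0 ulm].
wlog tu : t u t0 tlm u0 ulm / t <= u => [wlg|].
  have [/wlg|/ltW/wlg] := leP t u; first exact.
  by rewrite distrC (distance_sym dr); apply.
case: (leP u l) => [ul|lu].
  by rewrite (le_trans tu ul); apply: gP; rewrite in_itv/= ?t0 ?u0 ?ul ?(le_trans tu).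
have hu : u - l \in `[0, m] by rewrite in_itv/=; lra.
case: (leP t l) => [tl|lt].
  apply: le_trans (distance_triangle dr _ y _) _.
  have -> : `|t - u| = `|t - l| + `|0 - (u - l)|.
    by rewrite !ler0_norm; lra.
  apply: lerD.
    by rewrite -gl; apply: gP; rewrite in_itv/= ?t0 ?l0 ?lexx ?tl.
  by rewrite -h0; apply: hP => //; rewrite in_itv/= lexx.
have -> : t - u = (t - l) - (u - l) by ring.
by apply: hP => //; rewrite in_itv/=; lra.
Qed.

Lemma reachable_length (R : realType) (E : Type) (rho : E -> E -> R)
    (x y : E) (l : R) :
  reachable rho x y l ->
  exists g : R -> E, [/\ lipschitz_curve rho g, g 0 = x, g 1 = y &
    (curve_length rho 0 1 g <= l%:E)%E].
Proof.
move=> [l0 [g [g0 gl gP]]].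
have lip : {in `[0, 1] &, forall t u : R,
    rho (g (l * t)) (g (l * u)) <= l * `|t - u|}.
  move=> t u; rewrite !in_itv/= => /andP[t0 t1] /andP[u0 u1].
  rewrite -[X in _ <= X * _]ger0_norm// -normrM mulrBr.
  by apply: gP; rewrite in_itv/= ?mulr_ge0//= ?ler_piMr.
exists (fun t => g (l * t)); split.
- by exists l.
- by rewrite mulr0.
- by rewrite mulr1.
- by have := curve_length_lipschitz lip; rewrite subr0 mulr1.
Qed.

(** Only the upper bound on the infimum of lengths needs the curves: every curve
    is at least as long as the distance between its end points. *)
Lemma length_space_reachable (R : realType) (E : Type) (rho : E -> E -> R) :
  is_distance rho ->
  (forall x y (eps : R), 0 < eps ->
    exists2 l, l < rho x y + eps & reachable rho x y l) ->
  length_space rho.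
Proof.
move=> dr reach; split=> [|x y]; first exact: dr.
apply/eqP; rewrite eq_le; apply/andP; split.
  apply: le_ereal_inf_tmp => _ [g [_ g0 g1] <-].
  by rewrite -g0 -g1 (distance_sym dr); exact: distance_le_length.
apply/lee_addgt0Pr => eps eps0.
have [l lxy xyl] := reach x y eps eps0.
have [g [lip g0 g1 lenl]] := reachable_length xyl.
apply: (@le_trans _ _ (curve_length rho 0 1 g)).
  by apply: ereal_inf_lbound; exists g.
by apply: le_trans lenl _; rewrite -EFinD lee_fin ltW.
Qed.


(** * The Euclidean plane and the open square *)

Lemma eucl_is_distance (R : realType) : is_distance (@eucl R).
Proof.
split=> [p q|p q|p q|p q r].
- exact: sqrtr_ge0.
- split=> [/eqP|->]; last by rewrite /eucl !subrr expr0n/= addr0 sqrtr0.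
  rewrite sqrtr_eq0 => le0; case: p q le0 => [p1 p2] [q1 q2] /= le0.
  have := sqr_ge0 (p1 - q1); have := sqr_ge0 (p2 - q2) => h2 h1.
  have /eqP : (p1 - q1) ^+ 2 = 0 by lra.
  have /eqP : (p2 - q2) ^+ 2 = 0 by lra.
  by rewrite !sqrf_eq0 !subr_eq0 => /eqP -> /eqP ->.
- by rewrite /eucl; congr Num.sqrt; ring.
- rewrite /eucl; set a := p.1 - q.1; set b := p.2 - q.2.
  set c := q.1 - r.1; set d := q.2 - r.2.
  have -> : p.1 - r.1 = a + c by rewrite /a /c; ring.
  have -> : p.2 - r.2 = b + d by rewrite /b /d; ring.
  clearbody a b c d.
  have u0 : 0 <= a ^+ 2 + b ^+ 2 by rewrite addr_ge0 ?sqr_ge0.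
  have v0 : 0 <= c ^+ 2 + d ^+ 2 by rewrite addr_ge0 ?sqr_ge0.
  (* Cauchy-Schwarz. *)
  have cs : a * c + b * d <=
      Num.sqrt (a ^+ 2 + b ^+ 2) * Num.sqrt (c ^+ 2 + d ^+ 2).
    rewrite -sqrtrM//; apply: le_trans (ler_norm _) _.
    rewrite -sqrtr_sqr; apply: ler_wsqrtr.
    rewrite -subr_ge0.
    have -> : (a ^+ 2 + b ^+ 2) * (c ^+ 2 + d ^+ 2) - (a * c + b * d) ^+ 2 =
      (a * d - b * c) ^+ 2 by ring.
    exact: sqr_ge0.
  rewrite -[leRHS]ger0_norm ?addr_ge0 ?sqrtr_ge0// -sqrtr_sqr.
  by apply: ler_wsqrtr; rewrite [leRHS]sqrrD !sqr_sqrtr//; lra.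
Qed.

Lemma eucl_ge2 (R : realType) (p q : R * R) : `|p.2 - q.2| <= eucl p q.
Proof. by rewrite -sqrtr_sqr; apply: ler_wsqrtr; rewrite lerDr sqr_ge0. Qed.

Lemma eucl_le_norm (R : realType) (p q : R * R) :
  eucl p q <= `|p.1 - q.1| + `|p.2 - q.2|.
Proof.
rewrite -[leRHS]ger0_norm ?addr_ge0// -sqrtr_sqr; apply: ler_wsqrtr.
rewrite [leRHS]sqrrD !real_normK ?num_real//.
by have := mulr_ge0 (normr_ge0 (p.1 - q.1)) (normr_ge0 (p.2 - q.2)); lra.
Qed.

Lemma eucl_vertical (R : realType) (a h h' : R) : eucl (a, h) (a, h') = `|h - h'|.
Proof. by rewrite /eucl/= subrr expr0n add0r sqrtr_sqr. Qed.

Lemma eucl_horizontal (R : realType) (a a' h : R) :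
  eucl (a, h) (a', h) = `|a - a'|.
Proof. by rewrite /eucl/= subrr expr0n addr0 sqrtr_sqr. Qed.

Definition line_point (R : realType) (p q : R * R) (t : R) : R * R :=
  (p.1 + t * (q.1 - p.1), p.2 + t * (q.2 - p.2)).

Lemma line_point0 (R : realType) (p q : R * R) : line_point p q 0 = p.
Proof. by rewrite /line_point !mul0r !addr0 -surjective_pairing. Qed.

Lemma line_point1 (R : realType) (p q : R * R) : line_point p q 1 = q.
Proof.
by rewrite /line_point !mul1r !(addrC _ (_ - _)) !subrK -surjective_pairing.
Qed.

Lemma eucl_line_point (R : realType) (p q : R * R) (t u : R) :
  eucl (line_point p q t) (line_point p q u) = `|t - u| * eucl p q.
Proof.
rewrite /eucl /= -sqrtr_sqr -sqrtrM ?sqr_ge0//; congr Num.sqrt; ring.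
Qed.

Definition segment_closed (R : realType) (A : set (R * R)) : Prop :=
  forall p q t, A p -> A q -> 0 <= t <= 1 -> A (line_point p q t).

Lemma line_coord_bounds (R : realType) (a b t : R) :
  0 <= t <= 1 -> Num.min a b <= a + t * (b - a) <= Num.max a b.
Proof.
move=> /andP[t0 t1]; have [ab|/ltW ba] := leP a b.
  have h1 : 0 <= t * (b - a) by rewrite mulr_ge0// subr_ge0.
  have h2 : 0 <= (1 - t) * (b - a) by rewrite mulr_ge0 ?subr_ge0.
  by apply/andP; split; lra.
have h1 : 0 <= t * (a - b) by rewrite mulr_ge0// subr_ge0.
have h2 : 0 <= (1 - t) * (a - b) by rewrite mulr_ge0 ?subr_ge0.
by apply/andP; split; lra.
Qed.

Lemma line_coord_gt (R : realType) (c a b t : R) :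
  c < a -> c < b -> 0 <= t <= 1 -> c < a + t * (b - a).
Proof.
move=> ca cb /(line_coord_bounds a b)/andP[+ _].
by apply: lt_le_trans; rewrite lt_min ca.
Qed.

Lemma line_coord_lt (R : realType) (c a b t : R) :
  a < c -> b < c -> 0 <= t <= 1 -> a + t * (b - a) < c.
Proof.
move=> ac bc /(line_coord_bounds a b)/andP[_ +].
by move=> /le_lt_trans; apply; rewrite gt_max ac.
Qed.

Lemma line_coord_le (R : realType) (c a b t : R) :
  a <= c -> b <= c -> 0 <= t <= 1 -> a + t * (b - a) <= c.
Proof.
move=> ac bc /(line_coord_bounds a b)/andP[_ +].
by move=> /le_trans; apply; rewrite ge_max ac.
Qed.

Lemma Omega_segment_closed (R : realType) : segment_closed (Omega R).
Proof.
move=> p q t [/=]; rewrite !in_itv/= => /andP[p1 p1'] /andP[p2 p2'].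
move=> [/=]; rewrite !in_itv/= => /andP[q1 q1'] /andP[q2 q2'] t01.
by split; rewrite /= in_itv/= line_coord_gt// line_coord_lt.
Qed.

Lemma valP_Omega (R : realType) (x : Omega R) : Omega R (val x).
Proof. exact: set_mem (valP x). Qed.

Lemma eucl_Omega_is_distance (R : realType) : is_distance (@eucl_Omega R).
Proof. exact: is_distance_pullback val_inj (eucl_is_distance R). Qed.

(** The straight segment, run through in time [k * eucl_Omega x y].  The
    points of the plane that it visits are turned into points of the square by
    [insubd], which keeps them since the square is convex.  When [x = y] the
    time is [0], and [t / 0 = 0] makes the formula a constant curve. *)
Lemma reachable_segment (R : realType) (rho : Omega R -> Omega R -> R)
    (A : set (R * R)) (k : R) (x y : Omega R) :
  0 <= k -> is_distance rho -> segment_closed A ->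
  (forall z w : Omega R, A (val z) -> A (val w) ->
    rho z w <= k * eucl_Omega z w) ->
  A (val x) -> A (val y) -> reachable rho x y (k * eucl_Omega x y).
Proof.
move=> k0 dr Aconv rhok Ax Ay.
set l := k * _.
have l0 : 0 <= l by rewrite mulr_ge0// (distance_ge0 (eucl_Omega_is_distance R)).
have pOmega t : 0 <= t <= 1 -> Omega R (line_point (val x) (val y) t).
  by move=> t01; apply: Omega_segment_closed => //; exact: valP_Omega.
pose g t := insubd x (line_point (val x) (val y) (t / l)).
have gE t : 0 <= t / l <= 1 -> val (g t) = line_point (val x) (val y) (t / l).
  by move=> /pOmega/mem_set h; rewrite /g val_insubd h.
have div01 t : t \in `[0, l] -> 0 <= t / l <= 1.
  rewrite in_itv/= => /andP[t0 tl]; rewrite divr_ge0//=.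
  have [->|ln0] := eqVneq l 0; first by rewrite invr0 mulr0 ler01.
  by rewrite ler_pdivrMr ?mul1r// lt_neqAle eq_sym ln0.
split=> //; exists g; split.
- by apply: val_inj; rewrite gE ?mul0r ?lexx ?ler01// line_point0.
- have [le0|ln0] := eqVneq l 0.
    (* [l = 0] forces [x = y], as [rho x y <= l]. *)
    apply/esym/(distance_eq0 dr)/eqP; rewrite eq_le (distance_ge0 dr) andbT.
    rewrite -le0 /l {1}/g; have -> : insubd x (line_point (val x) (val y) (l / l)) = x.
      by apply: val_inj; rewrite gE le0 mul0r ?lexx ?ler01// line_point0.
    by rewrite (distance_sym dr); exact: rhok.
  by apply: val_inj; rewrite gE divff// ?ler01 ?lexx// line_point1.
- move=> t u /div01 t01 /div01 u01.
  apply: le_trans (rhok _ _ _ _) _; rewrite ?gE//; try exact: Aconv.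
  rewrite /eucl_Omega !gE// eucl_line_point -mulrBl normrM (ger0_norm (x := l^-1)) ?invr_ge0//.
  have -> : k * (`|t - u| / l * eucl (val x) (val y)) = `|t - u| * (l / l).
    by rewrite /l /eucl_Omega; ring.
  have [->|ln0] := eqVneq l 0; first by rewrite mul0r mulr0.
  by rewrite divff// mulr1.
Qed.

(** [S] is a subset of the plane rather than of the square, so that it may be
    the bottom edge. *)
Definition shortcut_Omega (R : realType) (S : set (R * R)) (x y : Omega R) : R :=
  shortcut (@eucl R) S (val x) (val y).

Lemma shortcut_Omega_is_distance (R : realType) (S : set (R * R)) :
  is_distance (@shortcut_Omega R S).
Proof.
exact: is_distance_pullback val_inj (shortcut_is_distance S (eucl_is_distance R)).
Qed.

(** Each leg of a route is a segment whose [d_S]-length is at most its cost: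
    slow legs because [d_S] is at most twice the Euclidean distance everywhere,
    the cheap leg because it stays in the convex set [S]. *)
Lemma shortcut_Omega_length_space (R : realType) (S : set (R * R)) :
  S `<=` Omega R -> segment_closed S -> length_space (@shortcut_Omega R S).
Proof.
move=> SO Sconv; have de := eucl_is_distance R.
have dS := shortcut_Omega_is_distance S.
have slow x y : reachable (shortcut_Omega S) x y (2 * eucl_Omega x y).
  apply: (reachable_segment (A := setT)) => // z w _ _.
  exact: shortcut_le2.
have fast x y : S (val x) -> S (val y) ->
    reachable (shortcut_Omega S) x y (eucl_Omega x y).
  move=> Sx Sy; rewrite -[eucl_Omega x y]mul1r.
  apply: (reachable_segment (A := S)) => // z w Sz Sw.
  by rewrite mul1r; exact: shortcut_fast.
apply: length_space_reachable => // x y eps eps0.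
have [|l] := inf_adherent (E := route_costs (@eucl R) S (val x) (val y)) eps0.
  split; first by exists (2 * eucl (val x) (val y)); left.
  by exists (eucl (val x) (val y)); exact: le_route_cost.
move=> [->|[s [t [Ss St ->]]]] lt; first by exists (2 * eucl_Omega x y).
pose s' : Omega R := SigSub (mem_set (SO _ Ss)).
pose t' : Omega R := SigSub (mem_set (SO _ St)).
exists (2 * eucl_Omega x s' + eucl_Omega s' t' + 2 * eucl_Omega t' y) => //.
apply: reachable_trans => //; apply: reachable_trans => //.
by apply: fast.
Qed.

Lemma shortcut_Omega_D2 (R : realType) (S : set (R * R)) :
  S `<=` Omega R -> segment_closed S -> D2 (@shortcut_Omega R S).
Proof.
move=> SO Sconv; split; first exact: shortcut_Omega_length_space.
move=> x y; have de := eucl_is_distance R.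
apply/andP; split; last exact: shortcut_le2.
apply: le_trans (shortcut_ge S (val x) (val y) de).
by have := distance_ge0 de (val x) (val y); rewrite /eucl_Omega; lra.
Qed.

(** * Lipschitz curves in the square *)

(** The height is continuous along the curve and attains its minimum. *)
Lemma lipschitz_curve_height (R : realType) (g : R -> Omega R) :
  lipschitz_curve (@eucl_Omega R) g ->
  exists2 m, 0 < m & {in `[0, 1], forall t, m <= (val (g t)).2}.
Proof.
move=> [k lip].
have cont : {within `[0, 1], continuous (fun t => (val (g t)).2)}.
  apply/subspace_continuousP => t tI; apply/cvgrPdist_le => eps eps0.
  have k0 : 0 < `|k| + 1 by rewrite ltr_wpDl.
  rewrite near_withinE; near=> u => uI.
  apply: le_trans (eucl_ge2 (val (g t)) (val (g u))) _.
  apply: le_trans (lip _ _ tI uI) _.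
  apply: (@le_trans _ _ ((`|k| + 1) * `|t - u|)).
    by apply: ler_wpM2r => //; have := ler_norm k; lra.
  rewrite -ler_pdivlMl// mulrC ltW//.
  near: u; apply: cvgr_dist_lt; [exact: cvg_id|exact: divr_gt0].
have [c cI cmin] := EVT_min (@ler01 R) cont.
exists (val (g c)).2; last by move=> t /cmin.
by have [_ /=] := valP_Omega (g c); rewrite in_itv/= => /andP[].
Unshelve. all: by end_near. Qed.

(** Half of [eps] for each coordinate: the uniformity of the square comes from
    the maximum norm, and the Euclidean norm is at most the sum of the
    coordinates. *)
Lemma Lip_cvg_dist (R : realType) (x_ : nat -> Lip R) (x : Lip R) (eps : R) :
  x_ @ \oo --> x -> 0 < eps ->
  \forall n \near \oo, forall t, t \in `[0, 1] ->
    eucl_Omega (val (x_ n) t) (val x t) <= eps.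
Proof.
move=> xcvg eps0.
have vcvg : (fun n => val (x_ n)) @ \oo --> val x.
  apply: cvg_comp xcvg _. exact: initial_continuous.
have /vcvg : nbhs (val x) [set h : {uniform` `[0 : R, 1] -> Omega R} |
    forall t, t \in `[0, 1] -> eucl_Omega (h t) (val x t) <= eps].
  apply/uniform_nbhs.
  exists [set yz : Omega R * Omega R | ball (val yz.1) (eps / 2) (val yz.2)].
  split.
    exists [set yz : (R * R) * (R * R) | ball yz.1 (eps / 2) yz.2] => //.
    by rewrite -entourage_ballE; exists (eps / 2) => //=; exact: divr_gt0.
  move=> h hball t tI; have [] := hball t tI.
  rewrite /ball/= => b1 b2; rewrite (distance_sym (eucl_Omega_is_distance R)).
  apply: le_trans (eucl_le_norm _ _) _.
  move: b1 b2; rewrite /ball_/=; lra.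
by [].
Qed.

(** * Gamma-convergence of the lengths *)

Lemma limn_einf_ge (R : realType) (u : nat -> \bar R) (c : \bar R) :
  (\forall n \near \oo, (c <= u n)%E) -> (c <= limn_einf u)%E.
Proof.
move=> [N _ cu]; rewrite limn_einf_lim; apply: lime_ge; first exact: is_cvg_einfs.
exists N => // n Nn; apply: le_ereal_inf_tmp => _ [k nk <-].
by apply: cu; exact: leq_trans nk.
Qed.

Lemma limn_esup_le (R : realType) (u : nat -> \bar R) (c : \bar R) :
  (forall n, (u n <= c)%E) -> (limn_esup u <= c)%E.
Proof.
move=> uc; rewrite limn_esup_lim; apply: lime_le; first exact: is_cvg_esups.
by apply: nearW => n; apply: ge_ereal_sup => _ [k _ <-].
Qed.

(** A curve that avoids [S] does not profit from it: if it is [k]-Lipschitz,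
    points whose parameters differ by at most [r / (`|k| + 1)] are at distance
    at most [r], hence no closer to [S] than to each other, and
    [shortcut_far] applies. *)
Lemma length_le_shortcut (R : realType) (S : set (R * R)) (r : R)
    (g : R -> Omega R) :
  lipschitz_curve (@eucl_Omega R) g -> 0 < r ->
  (forall t s, t \in `[0, 1] -> S s -> r <= eucl (val (g t)) s) ->
  (curve_length (shortcut_Omega set0) 0 1 g <=
   curve_length (shortcut_Omega S) 0 1 g)%E.
Proof.
move=> [k lip] r0 far; have de := eucl_is_distance R.
have k0 : 0 < `|k| + 1 by rewrite ltr_wpDl.
apply: (curve_length_local (eta := r / (`|k| + 1))).
- exact: shortcut_Omega_is_distance.
- exact: divr_gt0.
move=> t u tI uI; rewrite ler_pdivlMr// => tu.
rewrite /shortcut_Omega shortcut0// shortcut_far// => s Ss.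
apply: le_trans (far t s tI Ss); apply: le_trans tu.
apply: le_trans (lip _ _ tI uI) _; rewrite mulrC ler_wpM2l//.
by have := ler_norm k; lra.
Qed.

(** For large [n] the curve [x_ n] keeps the distance [r / 2] to [S_ n], so its
    length is twice the Euclidean one, which is lower semicontinuous.  The
    Lipschitz constants of the curves [x_ n] may be unbounded: each of them
    only serves to refine a partition for that [n]. *)
Lemma liminf_length_shortcut (R : realType) (S_ : nat -> set (R * R))
    (x_ : nat -> Lip R) (x : Lip R) (r : R) :
  0 < r -> x_ @ \oo --> x ->
  (\forall n \near \oo, forall (t : R) s, t \in `[0, 1] -> S_ n s ->
    r <= eucl (val (val x t)) s) ->
  (length_Lip (shortcut_Omega set0) x <=
   limn_einf (fun n => length_Lip (shortcut_Omega (S_ n)) (x_ n)))%E.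
Proof.
move=> r0 xcvg far; have de := eucl_is_distance R.
apply: curve_length_le => s ps.
apply/lee_subgt0Pr => eps eps0; rewrite -EFinB.
have r20 : 0 < r / 2 by exact: divr_gt0.
(* The [size s] steps of the partition each lose at most [2 * (2 * h)]: two end
   points, and distances that are twice the Euclidean one.  The successor
   avoids a division by zero. *)
pose h := eps / ((size s).+1%:R * 4).
have h0 : 0 < h by apply: divr_gt0 => //; rewrite mulr_gt0.
apply: limn_einf_ge; near=> n.
have farn : forall (t : R) s, t \in `[0, 1] -> S_ n s -> r <= eucl (val (val x t)) s.
  by near: n.
have closer : forall t : R, t \in `[0, 1] ->
    eucl_Omega (val (x_ n) t) (val x t) <= r / 2.
  by near: n; exact: Lip_cvg_dist.
have closeh : forall t : R, t \in `[0, 1] ->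
    eucl_Omega (val (x_ n) t) (val x t) <= h.
  by near: n; exact: Lip_cvg_dist.
have lip : lipschitz_curve (@eucl_Omega R) (val (x_ n)).
  exact: set_mem (valP (x_ n)).
apply: le_trans (length_le_shortcut lip r20 _); last first.
  move=> t z tI Sz; rewrite -(lerD2l (r / 2)) -splitr.
  apply: le_trans (farn t z tI Sz) _.
  apply: le_trans (distance_triangle de _ (val (val (x_ n) t)) _) _.
  by rewrite lerD2r (distance_sym de); exact: closer.
apply: le_trans (curve_length_ge _ _ ps); rewrite lee_fin lerBlDr.
have close2 : {in `[0, 1], forall t,
    shortcut_Omega set0 (val (x_ n) t) (val x t) <= 2 * h}.
  by move=> t tI; rewrite /shortcut_Omega shortcut0// ler_pM2l//; exact: closeh.
apply: le_trans (partition_sum_close _ close2 ps) _.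
  exact: shortcut_Omega_is_distance.
rewrite lerD2l.
have -> : eps = (size s).+1%:R * (2 * (2 * h)).
  have : (size s).+1%:R != 0 :> R by rewrite pnatr_eq0.
  by rewrite /h; move: (_.+1%:R) => N N0; field.
by rewrite ler_wpM2r ?ler_nat// !mulr_ge0// ltW.
Unshelve. all: by end_near. Qed.

(** * Strips shrinking to the bottom edge *)

Definition strip (R : realType) (n : nat) : set (R * R) :=
  [set p | Omega R p /\ p.2 <= n.+1%:R^-1].
Arguments strip : clear implicits.

Definition bottom_edge (R : realType) : set (R * R) :=
  [set p | 0 < p.1 < 1 /\ p.2 = 0].
Arguments bottom_edge : clear implicits.

Lemma strip_segment_closed (R : realType) (n : nat) : segment_closed (strip R n).
Proof.
move=> p q t [Op pn] [Oq qn] t01; split; first exact: Omega_segment_closed.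
exact: line_coord_le.
Qed.

Lemma strip_anti (R : realType) (n : nat) : strip R n.+1 `<=` strip R n.
Proof.
move=> p [Op pn]; split=> //; apply: le_trans pn _.
by rewrite lef_pV2 ?posrE// ler_nat.
Qed.

(** The constant sequence is a recovery sequence because every [d_n] is at most
    the limit. *)
Lemma Gamma_cvg_strip (R : realType) :
  Gamma_cvg (fun n => length_Lip (shortcut_Omega (strip R n)))
            (length_Lip (shortcut_Omega set0)).
Proof.
move=> x; split=> [x_ xcvg|]; last first.
  exists (fun=> x); first exact: cvg_cst.
  apply: limn_esup_le => n; apply: le_curve_length => y z.
  by apply: shortcut_anti => //; exact: eucl_is_distance.
have [m m0 xm] := lipschitz_curve_height (set_mem (valP x)).
have m20 : 0 < m / 2 by exact: divr_gt0.
apply: (liminf_length_shortcut (r := m / 2)) => //.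
near=> n => t s tI [_ sn]; apply: le_trans (eucl_ge2 _ _).
have nm : n.+1%:R^-1 <= m / 2 by apply/ltW; near: n; exact: (near_infty_natSinv_lt (PosNum m20)).
apply: le_trans (ler_norm _); rewrite lerBrDr.
apply: le_trans (xm t tI); rewrite [leRHS]splitr lerD2l.
exact: le_trans sn nm.
Unshelve. all: by end_near. Qed.

Lemma strip_near_edge (R : realType) (n : nat) (p : R * R) :
  strip R n p -> exists2 q, bottom_edge R q & eucl p q <= n.+1%:R^-1.
Proof.
case: p => a b [[/=]]; rewrite !in_itv/= => a01 /andP[b0 _] bn.
by exists (a, 0) => //; rewrite eucl_vertical subr0 gtr0_norm.
Qed.

Lemma edge_near_strip (R : realType) (n : nat) (p : R * R) :
  bottom_edge R p -> exists2 q, strip R n q & eucl p q <= n.+1%:R^-1.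
Proof.
case: p => a b [/= a01 ->].
have d0 : 0 < n.+1%:R^-1 :> R by rewrite invr_gt0.
have d1 : n.+1%:R^-1 <= 1 :> R by rewrite invf_le1// ler1n.
rewrite /strip; move: (n.+1%:R^-1) d0 d1 => d d0 d1.
exists (a, d / 2).
  by split; [split; rewrite /= in_itv//=|] => /=; lra.
by rewrite eucl_vertical sub0r normrN gtr0_norm; lra.
Qed.

(** The strip and the edge are within Hausdorff distance [n.+1%:R^-1]. *)
Lemma dist_shortcut_strip (R : realType) (n : nat) (x y : Omega R) :
  `|shortcut_Omega (bottom_edge R) x y - shortcut_Omega (strip R n) x y| <=
  6 * n.+1%:R^-1.
Proof.
have de := eucl_is_distance R.
have d0 : 0 <= n.+1%:R^-1 :> R by rewrite invr_ge0.
rewrite ler_distlC lerBlDr; apply/andP; split.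
  exact: shortcut_close (@strip_near_edge R n).
exact: shortcut_close (@edge_near_strip R n).
Qed.

Lemma uniform_cvg_strip (R : realType) (A : set (Omega R * Omega R)) :
  {uniform A, (fun n => uncurry (shortcut_Omega (strip R n))) @ \oo -->
    uncurry (shortcut_Omega (bottom_edge R))}.
Proof.
move=> P /uniform_nbhs[U [entU UP]].
move: entU; rewrite -entourage_ballE => -[eps /= eps0 epsU].
have e60 : 0 < eps / 6 by exact: divr_gt0.
near=> n; apply: UP => -[x y] _; apply: epsU => /=.
apply: le_lt_trans (dist_shortcut_strip n x y) _.
rewrite -ltr_pdivlMl// mulrC.
near: n; exact: (near_infty_natSinv_lt (PosNum e60)).
Unshelve. all: by end_near. Qed.

(** Witness: two points at height [1 / 16] and horizontal distance [1 / 2].  The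
    direct way costs [1], the way along the edge
    [2 / 16 + 1 / 2 + 2 / 16 = 3 / 4]. *)
Lemma shortcut_edge_neq (R : realType) :
  shortcut_Omega (bottom_edge R) <> (fun x y => 2 * eucl_Omega x y).
Proof.
have Op (a : R) : 0 < a < 1 -> Omega R (a, 16^-1).
  by move=> a01; split; rewrite /= in_itv//=; lra.
have O1 : Omega R (4^-1, 16^-1) by apply: Op; lra.
have O2 : Omega R (3 / 4, 16^-1) by apply: Op; lra.
pose x : Omega R := SigSub (mem_set O1).
pose y : Omega R := SigSub (mem_set O2).
move=> /(congr1 (fun rho => rho x y)); rewrite /shortcut_Omega/=.
have : route_costs (@eucl R) (bottom_edge R) (val x) (val y)
    (2 * eucl (val x) (4^-1, 0) + eucl (4^-1, 0) (3 / 4, 0) +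
     2 * eucl (3 / 4, 0) (val y)).
  by right; exists (4^-1, 0), (3 / 4, 0); split=> //; split=> //=; lra.
move=> /(shortcut_le (eucl_is_distance R)).
rewrite /eucl_Omega /= !eucl_vertical !eucl_horizontal => + eq.
rewrite {}eq.
have -> : `|4^-1 - 3 / 4| = 2^-1 :> R by rewrite ler0_norm; lra.
have -> : `|16^-1 - 0| = 16^-1 :> R by rewrite ger0_norm; lra.
have -> : `|0 - 16^-1| = 16^-1 :> R by rewrite ler0_norm; lra.
lra.
Qed.

Theorem lemma4p1 (R : realType) :
  let d : Omega R -> Omega R -> R := fun x y => 2 * eucl_Omega x y in
  D2 d /\
  exists (d_ : nat -> Omega R -> Omega R -> R) (dt : Omega R -> Omega R -> R),
    [/\ forall n, D2 (d_ n),
        increasing_distances d_,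
        is_distance dt /\ dt <> d,
        Gamma_cvg (fun n => length_Lip (d_ n)) (length_Lip d) &
        {family compact, (fun n => uncurry (d_ n)) @ \oo --> uncurry dt}].
Proof.
move=> d.
have dE : d = shortcut_Omega set0.
  by rewrite /shortcut_Omega shortcut0//; exact: eucl_is_distance.
split.
  by rewrite dE; apply: shortcut_Omega_D2 => // p q t [].
exists (fun n => shortcut_Omega (strip R n)), (shortcut_Omega (bottom_edge R)).
split.
- move=> n; apply: shortcut_Omega_D2; last exact: strip_segment_closed.
  by move=> p [].
- move=> n x y; apply: shortcut_anti; first exact: eucl_is_distance.
  exact: strip_anti.
- by split; [exact: shortcut_Omega_is_distance|exact: shortcut_edge_neq].
- by rewrite dE; exact: Gamma_cvg_strip.
- by apply/fam_cvgP => A _; exact: uniform_cvg_strip.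
Qed.
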